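(* Let $C$ be an ideal of $\mathcal{R}=\frac{GR(p^a,m)[x]}{\langle f(x)\rangle}$. Then there exists a generating set in standard form for $C$.
   Context: $p$ is a prime, $a,m\ge 1$; $GR(p^a,m)$ is the Galois ring of characteristic $p^a$ with $p^{am}$ elements, with maximal ideal $\langle p\rangle$ and residue field $\mathbb{F}_{p^m}$; a bar denotes reduction modulo $p$. $\mathcal{T}_m\subset GR(p^a,m)$ is the Teichmüller set $\{0,1,\zeta,\dots,\zeta^{p^m-2}\}$ ($\zeta$ of multiplicative order $p^m-1$), identified with $\mathbb{F}_{p^m}$. A polynomial in $GR(p^a,m)[x]$ is regular if it is not a zero divisor, primary if it generates a primary ideal, and basic irreducible if it is irreducible with irreducible reduction modulo $p$. Standing assumption: $f(x)\in GR(p^a,m)[x]$ is a monic regular primary polynomial which is not a unit, written as $f(x)=h(x)^t+p\beta(x)$ with $t\ge 1$, $h(x)$ a monic basic irreducible polynomial with $\overline{h}(x)=h(x)$ (coefficients in $\mathcal{T}_m$), $\beta(x)\in GR(p^a,m)[x]$ and $\deg\beta(x)<t\deg h(x)$. Elements of $\mathcal{R}$ are represented by polynomials of degree less than $\deg f(x)$. Definition. A set $G=\{p^{j_0}f_{j_0}(x),\dots,p^{j_r}f_{j_r}(x)\}\subset\mathcal{R}$, for some $0\le r\le a-1$, which generates $C$ is a generating set in standard form for $C$ if: (1) $0\le j_0<\dots<j_r\le a-1$; (2) $t>k_{j_0}>\dots>k_{j_r}\ge 0$; (3) $f_{j_i}(x)=h(x)^{k_{j_i}}+\sum_{\ell=1}^{a-1-j_i}p^{\ell}h(x)^{t_{j_i,\ell}}\alpha_{j_i,\ell}(x)$,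 where $t_{j_i,\ell}\deg(h(x))+\deg(\alpha_{j_i,\ell}(x))<k_{j_i}\deg(h(x))$ and each $\alpha_{j_i,\ell}(x)\notin\langle p,h(x)\rangle\setminus\{0\}$ (that is, each $\alpha_{j_i,\ell}(x)$ is either $0$ or not in $\langle p,h(x)\rangle$); (4) $p^{j_{i+1}}f_{j_i}(x)\in\langle p^{j_{i+1}}f_{j_{i+1}}(x),\dots,p^{j_r}f_{j_r}(x)\rangle$ for $0\le i<r$; (5) $p^{j_0}f(x)\in\langle p^{j_0}f_{j_0}(x),\dots,p^{j_r}f_{j_r}(x)\rangle$ in $GR(p^a,m)[x]$.
   Formalization: The ideal C is assumed nonzero: the definition requires at least one generator p^{j_0}f_{j_0}(x) with j_0 ≤ a-1 and k_{j_0} < t, which is nonzero in R, so the zero ideal has no generating set in standard form. *)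

(* Defs.v *)
From HB Require Import structures.
From mathcomp Require Import all_boot all_order all_algebra.

Set Implicit Arguments.
Unset Strict Implicit.
Unset Printing Implicit Defensive.

Import GRing.Theory.
Local Open Scope ring_scope.

(* MathComp's [idealr] is restricted to proper ideals, and its unit predicate
   on [{poly R}] requires [R] to be an integral domain; neither is suitable for
   polynomials over a Galois ring, hence the notions below. *)
Section CommutativeRings.
Variable R : comNzRingType.

Definition is_ideal (I : R -> Prop) : Prop :=
  [/\ I 0, forall u v, I u -> I v -> I (u + v) & forall c u, I u -> I (c * u)].

Definition ideal_gen (s : seq R) (x : R) : Prop :=
  exists c : 'I_(size s) -> R, x = \sum_(i < size s) c i * s`_i.

Definition is_unit (x : R) : Prop := exists y, x * y = 1.

Definition zero_divisor (x : R) : Prop := exists2 y, y != 0 & x * y = 0.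

Definition irreducible_elt (x : R) : Prop :=
  [/\ x <> 0, ~ is_unit x &
      forall u v, x = u * v -> is_unit u \/ is_unit v].

(* The exponent [n] is automatically positive, since [I] is proper. *)
Definition primary_ideal (I : R -> Prop) : Prop :=
  [/\ is_ideal I, ~ I 1 &
      forall u v, I (u * v) -> I u \/ exists n, I (v ^+ n)].

End CommutativeRings.

Definition regular_poly (R : comNzRingType) (f : {poly R}) : Prop :=
  ~ zero_divisor f.

Definition primary_poly (R : comNzRingType) (f : {poly R}) : Prop :=
  primary_ideal (ideal_gen [:: f]).

(* These conditions determine R up to isomorphism: a finite ring with p^(am)
   elements, of characteristic p^a, which is local with maximal ideal <p>,
   i.e. whose non-units are exactly the multiples of p. *)
Definition is_galois_ring (p a m : nat) (R : finComNzRingType) : Prop :=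
  [/\ forall n : nat, (n%:R == 0 :> R) = (p ^ a %| n)%N,
      #|R| = (p ^ (a * m))%N &
      forall x : R, ~ is_unit x <-> ideal_gen [:: p%:R] x].

Definition is_reduction_mod (p : nat) (R : comNzRingType) (K : fieldType)
    (red : {rmorphism R -> K}) : Prop :=
  (forall y, exists x, red x = y) /\
  (forall x, red x = 0 <-> ideal_gen [:: p%:R] x).

Definition basic_irreducible (R : comNzRingType) (K : fieldType)
    (red : {rmorphism R -> K}) (h : {poly R}) : Prop :=
  irreducible_elt h /\ irreducible_poly (map_poly red h).

Definition teichmuller (R : finComNzRingType) (zeta : R) (n : nat) : {set R} :=
  0 |: [set zeta ^+ i | i : 'I_n].

Section StandardForm.
Variables (R : finComNzRingType) (p a t : nat) (f h : {poly R}).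

Definition deg (g : {poly R}) : nat := (size g).-1.

(* Since [deg 0 = 0] whereas the zero polynomial has degree -oo, the degree
   bound is only required of the nonzero alpha. *)
Definition standard_shape (j k : nat) (g : {poly R}) : Prop :=
  exists (tau : nat -> nat) (alpha : nat -> {poly R}),
    g = h ^+ k + \sum_(1 <= l < a - j) p%:R ^+ l * h ^+ tau l * alpha l /\
    forall l, (1 <= l < a - j)%N -> alpha l <> 0 ->
      (tau l * deg h + deg (alpha l) < k * deg h)%N /\
      ~ ideal_gen [:: p%:R; h] (alpha l).

(* [j i], [k i] and [g i], for i <= r, stand for j_i, k_{j_i} and f_{j_i};
   their values at i > r are irrelevant. As r >= 0 and k_{j_0} < t, the first
   generator is nonzero: the zero ideal has no generating set of this form. *)
Definition standard_form (C G : {set {poly %/ f}}) : Prop :=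
  exists (r : nat) (j k : nat -> nat) (g : nat -> {poly R}),
  let to_quo : {poly R} -> {poly %/ f} := in_qpoly f in
  let gen i := p%:R ^+ j i * g i in
  [/\ (r <= a.-1)%N,
      G = [set x in [seq to_quo (gen i) | i <- iota 0 r.+1]] &
      forall x, x \in C <-> @ideal_gen {poly %/ f} (enum G) x] /\
  [/\ (j r <= a.-1)%N /\ (forall i, (i < r)%N -> (j i < j i.+1)%N),
      (k 0%N < t)%N /\ (forall i, (i < r)%N -> (k i.+1 < k i)%N),
      forall i, (i <= r)%N -> standard_shape (j i) (k i) (g i),
      forall i, (i < r)%N ->
        ideal_gen [seq to_quo (gen l) | l <- iota i.+1 (r - i)]
                  (to_quo (p%:R ^+ j i.+1 * g i)) &
      ideal_gen [seq gen l | l <- iota 0 r.+1] (p%:R ^+ j 0%N * f)].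

End StandardForm.

(* Main.v *)
Require Import Defs.
From HB Require Import structures.
From mathcomp Require Import all_boot all_order all_algebra.
From mathcomp Require Import ring.
From Stdlib Require Import Classical_Prop.

Set Implicit Arguments.
Unset Strict Implicit.
Unset Printing Implicit Defensive.

Import GRing.Theory.
Local Open Scope ring_scope.

(** Let [I] be the preimage of [C] in [GR[x]].  For each [s < a] the reductions
    modulo [p], written with a suffix [bar], of the [g] with [p^s g] in [I] form an ideal of [K[x]], the [s]-th
    torsion ideal of [I].  It contains the reduction [hbar^t] of [f], and [hbar]
    is irreducible, so it is generated by [hbar^(k_s)] for some [k_s <= t]
    ([torsion_ideal]); multiplying by [p] shows that [k_s] does not increase
    with [s].

    Each [hbar^(k_s)] is the reduction of a polynomial of standard shape
    ([standard_generator]).  A polynomial over [GR] with monic reduction need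
    not be monic, but it has a monic multiple with the same reduction
    ([monic_multiple_mod]).  This gives [p^s g] in [I] with [g] monic of degree
    [k_s deg h], so [g - h^(k_s)] has degree less than [k_s deg h] and is a
    multiple of [p].  Its [p]-adic digits, each divided by the largest power of
    [h] that divides it modulo [p], are the summands [p^l h^tau alpha]
    ([digit_expansion]).

    The standard generating set keeps only the [s] at which [k_s] drops, the
    drop from [t] included ([strict_descents]).  That it generates [C], and
    the two membership conditions on the generators, all follow from one division
    argument ([torsion_division]): if [p^s w] is in [I], then [hbar^(k_s)] divides [wbar],
    so subtracting a multiple of the generator at level [s] from [p^s w] leaves
    a multiple of [p^(s+1)] in [I], and after [a] steps nothing is left.  Since
    this works in [GR[x]], starting at level [j_i] it uses only the generators
    [i], ..., [r], and [f] enters only at the levels where [k_s = t], which lie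
    below [j_0].  Finally [C] is nonzero exactly when some [k_s] is less than
    [t], for otherwise the division leaves [I] inside the ideal of [f]. *)

(** * Ideals *)

Lemma ideal_genP (A : comNzRingType) (s : seq A) : is_ideal (ideal_gen s).
Proof.
split.
- by exists (fun=> 0); rewrite big1 // => i _; rewrite mul0r.
- move=> u v [c ->] [d ->]; exists (fun i => c i + d i).
  by rewrite -big_split; apply: eq_bigr => i _; rewrite mulrDl.
- move=> b u [c ->]; exists (fun i => b * c i).
  by rewrite mulr_sumr; apply: eq_bigr => i _; rewrite mulrA.
Qed.

Lemma mem_ideal_gen (A : comNzRingType) (s : seq A) x : x \in s -> ideal_gen s x.
Proof.
move=> /(nthP 0)[i lt_i <-]; exists (fun l => (l == Ordinal lt_i)%:R).
rewrite (bigD1 (Ordinal lt_i)) //= eqxx mul1r big1 ?addr0 // => l /negPf->.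
by rewrite mul0r.
Qed.

Lemma ideal_gen_min (A : comNzRingType) (I : A -> Prop) (s : seq A) :
  is_ideal I -> (forall x, x \in s -> I x) -> forall x, ideal_gen s x -> I x.
Proof.
move=> [I0 ID IM] sI x [c ->]; elim/big_rec: _ => // i y _ Iy.
by apply: ID => //; apply/IM/sI/mem_nth.
Qed.

Lemma idealB (A : comNzRingType) (I : A -> Prop) x y :
  is_ideal I -> I x -> I y -> I (x - y).
Proof. by move=> [_ ID IM] Ix Iy; rewrite -mulN1r; apply/ID/IM. Qed.

Lemma is_ideal_preim (A B : comNzRingType) (phi : {rmorphism A -> B})
    (I : B -> Prop) : is_ideal I -> is_ideal (fun x => I (phi x)).
Proof.
move=> [I0 ID IM]; split; first by rewrite rmorph0.
- by move=> u v Iu Iv; rewrite rmorphD; apply: ID.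
- by move=> c u Iu; rewrite rmorphM; apply: IM.
Qed.

(** * Ideals of K[x] containing a power of an irreducible polynomial *)

Lemma irreducible_power_decomp (K : fieldType) (q w : {poly K}) :
  (1 < size q)%N -> w != 0 ->
  exists i w', w = q ^+ i * w' /\ ~~ (q %| w').
Proof.
move=> q_gt1; have [n] := ubnP (size w).
elim: n w => // n IHn w lt_w w0; have [/dvdpP[w1 def_w]|ndvd] := boolP (q %| w).
- have w10 : w1 != 0 by apply: contraNneq w0 => w1E; rewrite def_w w1E mul0r.
  have q0 : q != 0 by rewrite -size_poly_gt0 ltnW.
  have lt_w1 : (size w1 < n)%N.
    move: lt_w; rewrite def_w size_mul //; move: q_gt1; case: (size q) => [|[|d]] // _.
    rewrite addnS /= => lt_n; rewrite -ltnS; apply: leq_ltn_trans lt_n.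
    by rewrite addnS ltnS leq_addr.
  have [i [w' [w1E ndvd]]] := IHn w1 lt_w1 w10.
  by exists i.+1, w'; split; rewrite // def_w w1E exprS; ring.
- by exists 0%N, w; rewrite mul1r.
Qed.

(** Take the least [k] with [q^k] in [J].  If an element [q^i w'] of [J], with
    [w'] prime to [q], had [i < k], then a Bezout relation between [w'] and [q^k]
    would put [q^i] in [J]. *)
Lemma ideal_irreducible_power (K : fieldType) (q : {poly K}) (J : {poly K} -> Prop) t :
  irreducible_poly q -> is_ideal J -> J (q ^+ t) ->
  exists k, [/\ (k <= t)%N, J (q ^+ k) & forall w, J w -> q ^+ k %| w].
Proof.
move=> q_irr J_ideal; have [J0 JD JM] := J_ideal; have [q_gt1 _] := q_irr.
elim: t => [|t IHt] Jt; first by exists 0%N; split=> // w _; apply: dvd1p.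
have [/IHt[k [le_kt Jk dvd_k]] | notJ] := classic (J (q ^+ t)).
  by exists k; split; rewrite // leqW.
exists t.+1; split=> // w Jw.
have [->|w0] := eqVneq w 0; first exact: dvdp0.
have [i [w' [def_w ndvd]]] := irreducible_power_decomp q_gt1 w0.
have [lt_ti | le_it] := ltnP t i; first by rewrite def_w dvdp_mulr ?dvdp_exp2l.
(* A Bezout relation puts q ^+ i in J, hence also q ^+ t, as i <= t. *)
have /Bezout_eq1_coprimepP[[u v] /= uv1] : coprimep w' (q ^+ t.+1).
  by rewrite coprimep_sym coprimep_expl // irreducible_poly_coprime.
case: notJ; have -> : q ^+ t = q ^+ (t - i) * (u * w + q ^+ i * v * q ^+ t.+1).
  have qtE : q ^+ t = q ^+ (t - i) * q ^+ i by rewrite -exprD subnK.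
  by rewrite -[LHS]mulr1 -uv1 {1}qtE def_w; ring.
by apply/JM/JD; apply: JM.
Qed.

Lemma size_monicXM (B : nzRingType) (g b : {poly B}) j : g \is monic -> b != 0 ->
  size (g ^+ j * b) = (j * (size g).-1 + size b)%N.
Proof.
move=> g_monic b0; elim: j => [|j IHj]; first by rewrite mul1r.
have sz_gt0 : (0 < size (g ^+ j * b)%R)%N by rewrite IHj addn_gt0 size_poly_gt0 b0 orbT.
rewrite exprS -mulrA size_monicM // -?size_poly_gt0 // IHj mulSn.
by rewrite -(prednK (_ : 0 < size g)%N) ?size_poly_gt0 ?monic_neq0 //= addnA.
Qed.

Lemma size_map_monic (B C : nzRingType) (phi : {rmorphism B -> C}) (g : {poly B}) :
  g \is monic -> size (map_poly phi g) = size g.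
Proof.
by move=> g_monic; rewrite size_map_poly_id0 // (monicP g_monic) rmorph1 oner_neq0.
Qed.

(** * Lifting along the reduction modulo p *)

Section Lifting.
Variables (p : nat) (A : comNzRingType) (K : fieldType) (red : {rmorphism A -> K}).
Hypothesis red_mod : is_reduction_mod p red.

Lemma red_p : map_poly red p%:R = 0.
Proof.
rewrite -polyC_natr map_polyC /=; have [_ /(_ p%:R)[_ ->]] := red_mod; rewrite ?polyC0 //.
by apply: mem_ideal_gen; rewrite inE.
Qed.

Lemma red_pX n : map_poly red (p%:R ^+ n.+1) = 0.
Proof. by rewrite rmorphXn /= red_p expr0n. Qed.

Lemma lift_poly (w : {poly K}) :
  exists2 g : {poly A}, map_poly red g = w & (size g <= size w)%N.
Proof.
have [s def_w] : exists s : seq A, map red s = w.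
  elim: {w}(polyseq w) => [|c s [s' <-]]; first by exists [::].
  by have [x <-] := red_mod.1 c; exists (x :: s').
exists (Poly s); last by rewrite -def_w size_map size_Poly.
apply/polyP=> i; rewrite coef_map coef_Poly /= -def_w.
have [lt_i|le_i] := ltnP i (size s); first by rewrite (nth_map 0).
by rewrite !nth_default ?rmorph0 ?size_map.
Qed.

Lemma red_poly_eq0 (g : {poly A}) : map_poly red g = 0 ->
  exists2 g', g = p%:R * g' & (size g' <= size g)%N.
Proof.
move=> g0; have [s def_g] : exists s : seq A, map ( *%R p%:R) s = g.
  have: forall x, x \in polyseq g -> red x = 0.
    by move=> x /(nthP 0)[i _ <-]; rewrite -coef_map g0 coef0.
  elim: (polyseq g) => [|c s IHs] cs0; first by exists [::].
  have [x Dx|s' <-] := IHs; first by apply: cs0; rewrite inE Dx orbT.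
  have /red_mod.2[b ->] : red c = 0 by apply: cs0; rewrite mem_head.
  by exists (b ord0 :: s'); rewrite big_ord1 /= mulrC.
exists (Poly s); last by rewrite -def_g size_map size_Poly.
apply/polyP=> i; rewrite -polyC_natr coefCM coef_Poly -{1}def_g.
have [lt_i|le_i] := ltnP i (size s); first by rewrite (nth_map 0).
by rewrite !nth_default ?mulr0 ?size_map.
Qed.

Lemma size_natXM n i (g : {poly A}) : (size (n%:R ^+ i * g)%R <= size g)%N.
Proof. by rewrite -natrX -polyC_natr mul_polyC size_scale_leq. Qed.

(** This is the existence half of Weierstrass preparation modulo [p^(n+1)], by
    successive approximation from any monic lift [f] of the reduction of [g].  If [v g = f + p^(n+1) e], divide [e] by the monic [f] as
    [q f + r]; then multiplying by [1 - p^(n+1) q] replaces the error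
    [p^(n+1) e] by [p^(n+1) r], which the next approximation absorbs without
    losing its leading term, up to a multiple of [p^(2n+2)]. *)
Lemma monic_multiple_mod n (g : {poly A}) : map_poly red g \is monic ->
  exists v f e, [/\ v * g = f + p%:R ^+ n.+1 * e, f \is monic
    & map_poly red f = map_poly red g].
Proof.
move=> g_monic; elim: n => [|n [v [f [e [def_f f_monic red_f]]]]].
  set w := map_poly red g in g_monic *.
  have [r red_r le_r] := lift_poly (w - 'X^((size w).-1)).
  have lt_r : (size r < size ('X^((size w).-1) : {poly A}))%N.
    have w_gt0 : (0 < size w)%N by rewrite size_poly_gt0 monic_neq0.
    rewrite size_polyXn (leq_ltn_trans le_r) // prednK //.
    rewrite -[X in (_ < X)%N](prednK w_gt0) ltnS.
    apply/leq_sizeP=> i; rewrite leq_eqVlt => /predU1P[<-|lt_i].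
      by rewrite coefB coefXn eqxx -lead_coefE (monicP g_monic) subrr.
    by rewrite coefB coefXn gtn_eqF // subr0 nth_default // -(prednK w_gt0).
  pose f : {poly A} := 'X^((size w).-1) + r.
  have red_f : map_poly red f = w by rewrite rmorphD /= map_polyXn red_r addrC subrK.
  have [|e def_e _] := @red_poly_eq0 (g - f); first by rewrite rmorphB /= red_f subrr.
  exists 1, f, e; split=> //; first by rewrite mul1r expr1 -def_e addrC subrK.
  by rewrite monicE lead_coefDl // lead_coefXn.
pose q := Pdiv.CommonRing.rdivp e f; pose r := Pdiv.CommonRing.rmodp e f.
have def_e : e = q * f + r := Pdiv.RingMonic.rdivp_eq f_monic e.
exists ((1 - p%:R ^+ n.+1 * q) * v), (f + p%:R ^+ n.+1 * r), (- p%:R ^+ n * q * e).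
split.
- have -> : r = e - q * f by rewrite [in RHS]def_e addrC addKr.
  by rewrite -[LHS]mulrA def_f !exprS; ring.
- have f_neq0 := monic_neq0 f_monic.
  rewrite monicE lead_coefDl ?(monicP f_monic) //.
  by rewrite (leq_ltn_trans (size_natXM _ _ _)) ?Pdiv.CommonRing.ltn_rmodpN0.
- by rewrite rmorphD rmorphM /= red_pX mul0r addr0.
Qed.

Variable h : {poly A}.
Hypotheses (h_monic : h \is monic) (hbar_gt1 : (1 < size (map_poly red h))%N).

(** One step of the [p]-adic expansion.  The factor [alpha] is a lift of minimal
    size of the cofactor of the largest power of [hbar] in the reduction of [u];
    as [h] is monic, no degree is gained. *)
Lemma leading_digit N (u : {poly A}) : (size u <= N)%N ->
  exists tau alpha u', [/\ u = h ^+ tau * alpha + p%:R * u', (size u' <= N)%N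
    & alpha <> 0 -> (tau * (size h).-1 + size alpha <= N)%N
                    /\ ~~ (map_poly red h %| map_poly red alpha)].
Proof.
move=> le_uN; have [/red_poly_eq0[u' uE le_u'] | u_neq0] := eqVneq (map_poly red u) 0.
  by exists 0%N, 0, u'; rewrite mulr0 add0r; split=> //; apply: leq_trans le_uN.
have [i [w [uE ndvd]]] := irreducible_power_decomp hbar_gt1 u_neq0.
have [alpha red_alpha le_alpha] := lift_poly w.
have w_neq0 : w != 0 by apply: contraNneq ndvd => ->; apply: dvdp0.
have le_N : (i * (size h).-1 + size alpha <= N)%N.
  apply: leq_trans le_uN; apply: leq_trans (size_poly _ _ : size (map_poly red u) <= _)%N.
  by rewrite uE size_monicXM ?monic_map // size_map_monic // leq_add2l.
have [|u' u'E le_u'] := @red_poly_eq0 (u - h ^+ i * alpha).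
  by rewrite rmorphB rmorphM rmorphXn /= red_alpha uE subrr.
exists i, alpha, u'; split; first by rewrite -u'E addrC subrK.
  apply: leq_trans le_u' _; apply: leq_trans (size_polyD _ _) _.
  rewrite geq_max le_uN size_polyN; have [->|alpha0] := eqVneq alpha 0.
    by rewrite mulr0 size_poly0.
  by rewrite size_monicXM.
by rewrite red_alpha.
Qed.

(** The summation starts at [1] because [u] is a multiple of [p]; the remainder
    [v] disappears as soon as it is multiplied by a vanishing power of [p]. *)
Lemma digit_expansion n N (u : {poly A}) : (size u <= N)%N -> map_poly red u = 0 ->
  exists tau alpha v,
    [/\ u = \sum_(1 <= l < n.+1) p%:R ^+ l * h ^+ tau l * alpha l + p%:R ^+ n.+1 * v,
        (size v <= N)%N
      & forall l, (1 <= l < n.+1)%N -> alpha l <> 0 ->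
          (tau l * (size h).-1 + size (alpha l) <= N)%N
          /\ ~~ (map_poly red h %| map_poly red (alpha l))].
Proof.
move=> le_uN u0; elim: n => [|n [tau [alpha [v [uE le_vN digits]]]]].
  have [v uE le_vu] := red_poly_eq0 u0.
  exists (fun=> 0%N), (fun=> 0), v; split; last by case.
    by rewrite big_geq // add0r expr1.
  exact: leq_trans le_vu le_uN.
have [i [b [v' [vE le_v' b_digit]]]] := leading_digit le_vN.
exists (fun l => if l == n.+1 then i else tau l).
exists (fun l => if l == n.+1 then b else alpha l), v'; split=> //.
  rewrite big_nat_recr //= eqxx -addrA uE; congr (_ + _).
    by apply: eq_big_nat => l /andP[_ lt_l]; rewrite !ltn_eqF.
  by rewrite vE (exprSr _ n.+1) mulrDr !mulrA.
move=> l /andP[l_gt0]; rewrite ltnS leq_eqVlt => /predU1P[-> | lt_l].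
  by rewrite eqxx.
by rewrite ltn_eqF // => alpha0; apply: digits; rewrite ?l_gt0.
Qed.

End Lifting.

(** * Torsion ideals and generators of standard shape *)

Section Torsion.
Variables (p a : nat) (R : finComNzRingType) (K : fieldType) (red : {rmorphism R -> K}).
Hypotheses (red_mod : is_reduction_mod p red) (pXa : p%:R ^+ a = 0 :> {poly R}).
Variables (h : {poly R}).
Hypotheses (h_monic : h \is monic) (hbar_irr : irreducible_poly (map_poly red h)).
Variable I : {poly R} -> Prop.
Hypothesis I_ideal : is_ideal I.

(** The multiple of [p^a] left over from [monic_multiple_mod] is zero, and so is
    the one left by the expansion to [a - s - 1] digits once it is multiplied by
    [p^s].  Hence [p^s g'] is equal to [p^s] times a monic multiple of [g]. *)
Lemma standard_generator s k g : (s < a)%N ->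
  map_poly red g = map_poly red h ^+ k -> I (p%:R ^+ s * g) ->
  exists g', [/\ standard_shape p a h s k g', map_poly red g' = map_poly red h ^+ k
               & I (p%:R ^+ s * g')].
Proof.
move=> lt_sa red_g Ig; have [hbar_gt1 _] := hbar_irr; have [_ ID IM] := I_ideal.
have hbar_monic : map_poly red h ^+ k \is monic by rewrite monic_exp ?monic_map.
have [|v [f [e [vgE f_monic red_f]]]] := @monic_multiple_mod p R K red red_mod a.-1 g.
  by rewrite red_g.
rewrite prednK ?(leq_ltn_trans _ lt_sa) // pXa mul0r addr0 in vgE.
have size_hk : size (h ^+ k) = (k * deg h).+1.
  by rewrite -[h ^+ k]mulr1 size_monicXM ?oner_neq0 // size_poly1 addn1.
have size_f : size f = (k * deg h).+1.
  by rewrite -(size_map_monic red f_monic) red_f red_g -rmorphXn size_map_monic ?monic_exp.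
have le_u : (size (f - h ^+ k)%R <= k * deg h)%N.
  apply/leq_sizeP => i; rewrite leq_eqVlt coefB => /predU1P[<- | lt_i].
    have -> : (k * deg h)%N = (size f).-1 by rewrite size_f.
    rewrite -lead_coefE (monicP f_monic) size_f -size_hk -lead_coefE.
    by rewrite (monicP (monic_exp _ h_monic)) subrr.
  by rewrite !nth_default ?subr0 ?size_f ?size_hk.
have [|tau [alpha [w [uE _ digits]]]] :=
    @digit_expansion p R K red red_mod h h_monic hbar_gt1 (a - s).-1 _ _ le_u.
  by rewrite rmorphB rmorphXn /= red_f red_g subrr.
rewrite prednK ?subn_gt0 // in uE digits.
set g' := h ^+ k + \sum_(1 <= l < a - s) p%:R ^+ l * h ^+ tau l * alpha l.
have g'E : p%:R ^+ s * g' = p%:R ^+ s * f.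
  rewrite -[f](subrK (h ^+ k)) uE [_ + h ^+ k]addrC [in RHS]addrA.
  by rewrite [in RHS]mulrDr [X in _ + X]mulrA -exprD subnKC ?(ltnW lt_sa) // pXa mul0r addr0.
exists g'; split.
- exists tau, alpha; split=> // l lt_l alpha0.
  have [le_l ndvd] := digits l lt_l alpha0; split.
    apply: leq_trans le_l; rewrite -addnS leq_add2l prednK // size_poly_gt0; exact/eqP.
  case=> c; rewrite big_ord_recl big_ord1 /= => alphaE; case/negP: ndvd.
  by rewrite alphaE rmorphD !rmorphM /= (red_p red_mod) mulr0 add0r dvdp_mull.
- rewrite /g' rmorphD rmorphXn /= rmorph_sum big1_seq ?addr0 // => l.
  rewrite mem_index_iota => /andP[_ /andP[l_gt0 _]].
  by rewrite -mulrA rmorphM /= -(prednK l_gt0) (red_pX red_mod) mul0r.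
- by rewrite g'E -vgE mulrCA; apply: IM.
Qed.

(** The reductions of the [g] with [p^s g] in [I] are closed under multiplication
    by [K[x]] because polynomials over [K] lift along [red]. *)
Lemma torsion_ideal s t f : map_poly red f = map_poly red h ^+ t -> I f ->
  exists k, [/\ (k <= t)%N,
    exists2 g, I (p%:R ^+ s * g) & map_poly red g = map_poly red h ^+ k
    & forall w, I (p%:R ^+ s * w) -> map_poly red h ^+ k %| map_poly red w].
Proof.
move=> red_f If; have [I0 ID IM] := I_ideal.
pose J w := exists2 g, I (p%:R ^+ s * g) & map_poly red g = w.
have J_ideal : is_ideal J.
  split; first by exists 0; rewrite ?mulr0 ?rmorph0.
    move=> _ _ [u Iu <-] [v Iv <-]; exists (u + v); rewrite ?rmorphD //.
    by rewrite mulrDr; apply: ID.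
  move=> c _ [u Iu <-]; have [c' <- _] := lift_poly red_mod c.
  by exists (c' * u); rewrite ?rmorphM // mulrCA; apply: IM.
have Jt : J (map_poly red h ^+ t) by exists f => //; apply: IM.
have [k [le_kt Jk dvd_k]] := ideal_irreducible_power hbar_irr J_ideal Jt.
by exists k; split=> // w Iw; apply: dvd_k; exists w.
Qed.

(** Membership in an ideal [J] that contains a generator of each torsion ideal
    of [I] from level [s0] on: cancel [p]-adic digits one level at a time until
    [p^a = 0] is reached.  The target [J] is left arbitrary so that it can be an
    ideal of [GR[x]] or the preimage of an ideal of the quotient. *)
Lemma torsion_division (kf : nat -> nat) (J : {poly R} -> Prop) s0 :
  is_ideal J ->
  (forall s w, (s < a)%N -> I (p%:R ^+ s * w) ->
     map_poly red h ^+ kf s %| map_poly red w) ->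
  (forall s, (s0 <= s < a)%N -> exists g,
     [/\ I (p%:R ^+ s * g), J (p%:R ^+ s * g) & map_poly red g = map_poly red h ^+ kf s]) ->
  forall w, I (p%:R ^+ s0 * w) -> J (p%:R ^+ s0 * w).
Proof.
move=> [J0 JD JM] tor; have [n] := ubnP (a - s0).
elim: n s0 => // n IHn s lt_n gens w Iw; have [le_as | lt_sa] := leqP a s.
  by rewrite -(subnK le_as) exprD pXa mulr0 mul0r.
have [|g [Ig Jg red_g]] := gens s; first by rewrite leqnn.
have /dvdpP[c cE] := tor s w lt_sa Iw; have [c' red_c' _] := lift_poly red_mod c.
have [|w' w'E _] := @red_poly_eq0 p R K red red_mod (w - c' * g).
  by rewrite rmorphB rmorphM /= red_c' red_g cE subrr.
have wE : p%:R ^+ s.+1 * w' = p%:R ^+ s * w - c' * (p%:R ^+ s * g).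
  by rewrite exprSr -mulrA -w'E; ring.
have -> : p%:R ^+ s * w = c' * (p%:R ^+ s * g) + p%:R ^+ s.+1 * w' by rewrite wE addrC subrK.
apply: JD; first exact: JM.
apply: IHn; first by rewrite -ltnS subnSK.
  by move=> s' /andP[lt_s' lt_s'a]; apply: gens; rewrite (ltnW lt_s').
rewrite wE; apply: idealB => //; have [_ _ IM] := I_ideal; exact: IM.
Qed.

End Torsion.

(** * Levels at which the torsion ideal grows *)

(** The [j i] are the levels where [kf] drops strictly, the initial drop from
    [t] included; so from [j 0] on, every value of [kf] is already attained at
    the last drop.  The equation [kf (j r) = kf n] makes the induction on [n]
    work: it compares a drop at [n.+1] with the previous one. *)
Lemma strict_descents n t (kf : nat -> nat) :
  (forall s s', s <= s' <= n -> kf s' <= kf s)%N -> (forall s, kf s <= t)%N ->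
  (kf n < t)%N ->
  exists r (j : nat -> nat),
  [/\ (j r <= n)%N /\ kf (j r) = kf n, forall i, (i < r)%N -> (j i < j i.+1)%N,
      (kf (j 0%N) < t)%N, forall i, (i < r)%N -> (kf (j i.+1) < kf (j i))%N
    & forall s, (s <= n)%N ->
        kf s = t \/ exists i, [/\ (i <= r)%N, (j i <= s)%N & kf (j i) = kf s]].
Proof.
elim: n => [|n IHn] mono le_t lt_t.
  exists 0%N, (fun=> 0%N); split=> // s; rewrite leqn0 => /eqP->.
  by right; exists 0%N.
have [lt_n | le_tn] := ltnP (kf n) t; last first.
  exists 0%N, (fun=> n.+1); split=> // s; rewrite leq_eqVlt => /predU1P[-> | lt_s].
    by right; exists 0%N.
  left; apply/eqP; rewrite eqn_leq le_t (leq_trans le_tn) //.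
  by apply: mono; rewrite -ltnS lt_s leqnSn.
have [|r [j [[le_jr kr] j_mono lt_k0 k_mono last]]] := IHn _ le_t lt_n.
  by move=> s s' /andP[le_ss' le_s'n]; apply: mono; rewrite le_ss' leqW.
have : (kf n.+1 <= kf n)%N by apply: mono; rewrite leqnSn leqnn.
rewrite leq_eqVlt => /predU1P[eq_k | lt_k].
  exists r, j; split=> //; first by rewrite leqW ?eq_k.
  move=> s; rewrite leq_eqVlt => /predU1P[-> | lt_s]; last exact: last.
  by right; exists r; rewrite eq_k leqW.
exists r.+1, (fun i => if (i <= r)%N then j i else n.+1); split=> //.
- by rewrite ltnn.
- move=> i; rewrite ltnS => le_i; rewrite le_i; have [lt_i|ge_i] := ltnP i r; first exact: j_mono.
  by have -> : i = r by [apply/eqP; rewrite eqn_leq le_i].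
- move=> i; rewrite ltnS => le_i; rewrite le_i; have [lt_i|ge_i] := ltnP i r; first exact: k_mono.
  by have -> : i = r by [apply/eqP; rewrite eqn_leq le_i]; rewrite kr.
- move=> s; rewrite leq_eqVlt => /predU1P[-> | lt_s].
    by right; exists r.+1; rewrite ltnn.
  have [keq|[i [le_i le_ji ki]]] := last s lt_s; [by left|right].
  by exists i; rewrite le_i; split=> //; apply: leqW.
Qed.

Lemma chain_trans (T : Type) (e : rel T) (u : nat -> T) r : transitive e ->
  (forall i, (i < r)%N -> e (u i) (u i.+1)) ->
  forall i l, (i < l <= r)%N -> e (u i) (u l).
Proof.
move=> e_trans e_step i l /andP[]; elim: l => // l IHl.
rewrite ltnS leq_eqVlt => /predU1P[-> | lt_il] lt_lr; first exact: e_step.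
exact: e_trans (IHl lt_il (ltnW lt_lr)) (e_step l lt_lr).
Qed.

(** * Existence of a generating set in standard form *)

Theorem corollary3p13
  (p a m : nat) (p_prime : prime p) (a_gt0 : (0 < a)%N) (m_gt0 : (0 < m)%N)
  (GR : finComNzRingType) (GR_galois : is_galois_ring p a m GR)
  (K : finFieldType) (K_card : #|K| = (p ^ m)%N)
  (red : {rmorphism GR -> K}) (red_mod : is_reduction_mod p red)
  (zeta : GR) (zeta_prim : (p ^ m - 1)%N.-primitive_root zeta)
  (t : nat) (t_gt0 : (0 < t)%N)
  (f h beta : {poly GR})
  (f_monic : f \is monic) (f_regular : regular_poly f)
  (f_primary : primary_poly f) (f_nonunit : ~ is_unit f)
  (h_monic : h \is monic) (h_basic : basic_irreducible red h)
  (h_teich : forall i, h`_i \in teichmuller zeta (p ^ m - 1))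
  (f_eq : f = h ^+ t + p%:R * beta)
  (beta_deg : beta = 0 \/ (deg beta < t * deg h)%N)
  (C : {set {poly %/ f}}) (C_ideal : @is_ideal {poly %/ f} (fun x => x \in C))
  (C_neq0 : exists2 c, c \in C & c != 0) :
  exists G : {set {poly %/ f}}, standard_form p a t h C G.
Proof.
case: a a_gt0 GR_galois => // n _ [char_GR _ _]; have [_ hbar_irr] := h_basic.
have pXa : p%:R ^+ n.+1 = 0 :> {poly GR}.
  by rewrite -natrX -polyC_natr; have /eqP-> : (p ^ n.+1)%:R == 0 :> GR by rewrite char_GR.
have red_f : map_poly red f = map_poly red h ^+ t.
  by rewrite f_eq rmorphD rmorphM rmorphXn /= (red_p red_mod) mul0r addr0.
have f_gt1 : (1 < size f)%N.
  rewrite -(size_map_monic red f_monic) red_f -[_ ^+ t]mulr1.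
  rewrite size_monicXM ?monic_map ?oner_neq0 // size_poly1 addn1 ltnS muln_gt0 t_gt0.
  by have [] := hbar_irr; case: (size _) => [|[|d]].
pose phi : {rmorphism {poly GR} -> {poly %/ f}} := in_qpoly f.
have phi_f : phi f = 0.
  apply/val_inj; rewrite /= /mk_monic f_gt1 f_monic /=.
  exact: Pdiv.RingMonic.rmodpp.
have phi_val (x : {poly %/ f}) : phi (val x) = x.
  by apply/val_inj; rewrite /= Pdiv.CommonRing.rmodp_small ?size_mk_monic.
pose I u := phi u \in C.
have I_ideal : is_ideal I := is_ideal_preim phi C_ideal.
have [I0 ID IM] := I_ideal.
have If : I f by rewrite /I phi_f; case: C_ideal.
have gen_exists (s : 'I_n.+1) : exists kg : nat * {poly GR},
    [/\ (kg.1 <= t)%N, standard_shape p n.+1 h s kg.1 kg.2,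
        map_poly red kg.2 = map_poly red h ^+ kg.1, I (p%:R ^+ s * kg.2)
      & forall w, I (p%:R ^+ s * w) -> map_poly red h ^+ kg.1 %| map_poly red w].
  have [k [le_kt [g Ig red_g] tor]] := torsion_ideal red_mod hbar_irr I_ideal s red_f If.
  have [g' [shape_g' red_g' Ig']] :=
    standard_generator red_mod pXa h_monic hbar_irr I_ideal (ltn_ord s) red_g Ig.
  exists (k, g'); split=> /=; [exact: le_kt|exact: shape_g'|exact: red_g'|exact: Ig'|exact: tor].
have [kg kgP] := fin_all_exists gen_exists.
pose k s := (kg (inord s)).1; pose g s := (kg (inord s)).2.
have k_le s : (k s <= t)%N by have [] := kgP (inord s).
have gP s : (s <= n)%N ->
    [/\ standard_shape p n.+1 h s (k s) (g s),
        map_poly red (g s) = map_poly red h ^+ k s & I (p%:R ^+ s * g s)].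
  by move=> le_s; have := kgP (inord s); rewrite inordK // => -[].
have tor s w : (s < n.+1)%N -> I (p%:R ^+ s * w) -> map_poly red h ^+ k s %| map_poly red w.
  by move=> lt_s; have := kgP (inord s); rewrite inordK // => -[_ _ _ _]; apply.
have k_mono s s' : (s <= s' <= n -> k s' <= k s)%N.
  case/andP=> le_ss' le_s'n; have [_ red_g Ig] := gP s (leq_trans le_ss' le_s'n).
  have [hbar_gt1 _] := hbar_irr.
  rewrite -(dvdp_Pexp2l _ _ hbar_gt1) -red_g; apply: tor => //.
  by rewrite -(subnK le_ss') exprD -mulrA; apply: IM.
(* Otherwise f generates every torsion ideal, so C would be zero. *)
have k_lt : (k n < t)%N.
  rewrite ltnNge; apply/negP=> le_tk; have [c Cc /eqP[]] := C_neq0.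
  suff: ideal_gen [:: f] (val c).
    by case=> b; rewrite big_ord1 => cE; rewrite -(phi_val c) cE rmorphM phi_f mulr0.
  have := @torsion_division p n.+1 GR K red red_mod pXa h I I_ideal k _ 0%N
    (ideal_genP [:: f]) tor _ (val c).
  rewrite mul1r; apply; last by rewrite /I phi_val.
  move=> s /andP[_ lt_s]; exists f; split.
  - exact: IM.
  - by have [_ _ JM] := ideal_genP [:: f]; apply/JM/mem_ideal_gen/mem_head.
  rewrite red_f; congr (_ ^+ _); apply/eqP; rewrite eqn_leq k_le (leq_trans le_tk) //.
  by apply: k_mono; rewrite -ltnS lt_s leqnn.
have [r [j [[le_jr _] j_mono k0_lt kj_mono descent]]] := strict_descents k_mono k_le k_lt.
have j_inc i l : (i < l <= r)%N -> (j i < j l)%N.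
  exact: (chain_trans ltn_trans j_mono).
have kj_dec i l : (i < l <= r)%N -> (k (j l) < k (j i))%N.
  apply: (chain_trans (e := fun x y => (k y < k x)%N) _ kj_mono).
  by move=> y x z lt_xy lt_yz; apply: ltn_trans lt_xy.
have j_le i : (i <= r)%N -> (i <= j i <= n)%N.
  move=> le_ir; apply/andP; split.
    elim: i le_ir => // i IHi lt_ir; exact: leq_ltn_trans (IHi (ltnW lt_ir)) (j_mono i lt_ir).
  move: le_ir; rewrite leq_eqVlt => /predU1P[-> // | lt_ir].
  by apply: leq_trans le_jr; rewrite ltnW // j_inc // lt_ir leqnn.
have kj_lt i : (i <= r)%N -> (k (j i) < t)%N.
  case: i => // i lt_ir; apply: ltn_trans k0_lt; exact: kj_dec.
pose gen i := p%:R ^+ j i * g (j i).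
have Igen i : (i <= r)%N -> I (gen i).
  by case/j_le/andP=> _ /gP[].
pose G := [set x in [seq phi (gen i) | i <- iota 0 r.+1]].
(* The common source of the last two conditions on the generators. *)
have divide i w : (i <= r)%N -> I (p%:R ^+ j i * w) ->
    ideal_gen [seq gen l | l <- iota i (r.+1 - i)] (p%:R ^+ j i * w).
  move=> le_ir; apply: (torsion_division red_mod pXa I_ideal (ideal_genP _) tor).
  move=> s /andP[le_js lt_s]; case: (descent s lt_s) => [ks | [l [le_lr le_jl kl]]];
    have k_si : (k s <= k (j i))%N by apply: k_mono; rewrite le_js -ltnS.
    by rewrite ks leqNgt kj_lt in k_si.
  have le_il : (i <= l)%N.
    by rewrite leqNgt; apply/negP=> lt_li; rewrite leqNgt -kl kj_dec ?lt_li in k_si.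
  have [_ red_g Ig] := gP (j l) (leq_trans le_jl lt_s).
  exists (g (j l)); rewrite -kl red_g -(subnK le_jl) exprD -mulrA; split=> //.
    exact: IM.
  have [_ _ JM] := ideal_genP [seq gen l | l <- iota i (r.+1 - i)].
  apply/JM/mem_ideal_gen/map_f.
  by rewrite mem_iota le_il subnKC // leqW.
exists G, r, j, (fun i => k (j i)), (fun i => g (j i)) => /=; split; split=> //.
- have /j_le/andP[le_rj _] := leqnn r; exact: leq_trans le_jr.
- move=> x; split.
    have quo_ideal := is_ideal_preim phi (ideal_genP (enum G)); have [J0 _ JM] := quo_ideal.
    have := torsion_division red_mod pXa I_ideal (s0 := 0%N) quo_ideal tor _ (w := val x).
    rewrite mul1r /I phi_val => quo_division Cx; apply: quo_division => // s /andP[_ lt_s].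
    case: (descent s lt_s) => [ks | [i [le_ir le_js ki]]].
      exists f; rewrite red_f ks; split=> //; first exact: IM.
      by rewrite rmorphM phi_f mulr0 -(rmorph0 phi).
    have [_ red_g Ig] := gP (j i) (leq_trans le_js lt_s).
    exists (g (j i)); rewrite -ki red_g -(subnK le_js) exprD -mulrA; split=> //.
      exact: IM.
    apply/JM/mem_ideal_gen; rewrite mem_enum inE; apply: (map_f (phi \o gen)).
    by rewrite mem_iota add0n ltnS.
  apply: (ideal_gen_min C_ideal) => y; rewrite mem_enum inE => /mapP[i].
  by rewrite mem_iota add0n ltnS => /andP[_ le_ir] ->; apply: Igen.
- by move=> i /j_le/andP[_ /gP[]].
- move=> i lt_ir; set s := map _ _.
  apply: (ideal_gen_min (is_ideal_preim phi (ideal_genP s))); last first.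
    apply: divide => //; have /j_le/andP[_ /gP[_ _ Ig]] := ltnW lt_ir.
    by rewrite -(subnK (ltnW (j_mono i lt_ir))) exprD -mulrA; apply: IM.
  move=> _ /mapP[l lt_l ->]; apply: mem_ideal_gen; exact: (map_f (phi \o gen)).
- have := divide 0%N f (leq0n r); rewrite subn0; apply; exact: IM.
Qed.
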